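(* Let $A=\bigoplus_{i=1}^mB(X_i)$, $B=\bigoplus_{j=1}^nB(Y_j)$, $H$ a finite-dimensional Hilbert space, $\omega\in B(H)$ invertible with $\mathrm{Tr}(\omega^\dagger\omega)=1$, and $M:A\otimes B(H)\to B$ a channel with minimal dilation $\tau_{ij}:X_i\otimes H\to Y_j\otimes E_{ji}$. Let $\rho_1:=\mathrm{Tr}_{H_2}(W_\omega)\in B(H)$ be the reduced state of $W_\omega$ on the first tensor factor (the one on which $M$ acts). Then $M$ is entanglement-invertible with respect to $W_\omega$ if and only if (a) $M$ is entanglement-invertible with respect to the canonical maximally entangled state $\Phi_H$, and (b) $\rho_1$ is a self-intertwiner of $M$, i.e. there exist operators $g_{ij}\in B(E_{ji})$ with $\tau_{ij}(1_{X_i}\otimes\rho_1)=(1_{Y_j}\otimes g_{ij})\tau_{ij}$ for all $i,j$.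
   Context: All Hilbert spaces are finite-dimensional. A channel is a completely positive trace-preserving linear map (acting on states). $A\otimes B(H)=\bigoplus_iB(X_i\otimes H)$; a channel $M:A\otimes B(H)\to B$ has components $M_{ij}:B(X_i\otimes H)\to B(Y_j)$ with $M(\oplus_i\rho_i)=\oplus_j\sum_iM_{ij}(\rho_i)$. A minimal dilation of $M$ is a family of linear maps $\tau_{ij}:X_i\otimes H\to Y_j\otimes E_{ji}$ with $M_{ij}(\rho)=\mathrm{Tr}_{E_{ji}}(\tau_{ij}\rho\tau_{ij}^\dagger)$ such that, for an orthonormal basis $\{e_k\}$ of $E_{ji}$, the operators $(1\otimes\langle e_k|)\tau_{ij}$ are linearly independent. Fix an orthonormal basis $\{|h\rangle\}$ of $H$; $|\eta_H\rangle=\sum_h|h\rangle\otimes|h\rangle$, $\Phi_H=|\eta_H\rangle\langle\eta_H|/\dim H$; $W_\omega=|w_\omega\rangle\langle w_\omega|$ with $|w_\omega\rangle=\sum_h|h\rangle\otimes\omega|h\rangle\in H\otimes H$ (a pure state). For a state $W$ on $H_1\otimes H_2$ with swap $W'$, a channel $M:A\otimes B(H_1)\to B$ is entanglement-invertible with respect to $W$ if there is a channel $N:B\otimes B(H_2)\to A$ with $N\big((M\otimes\mathrm{id}_{B(H_2)})(\rho\otimes W)\big)=\rho$ for all $\rho\in A$ and $M\big((N\otimes\mathrm{id}_{B(H_1)})(\sigma\otimes W')\big)=\sigma$ for all $\sigma\in B$. Here $H_1=H_2=H$. *)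

(* Defs.v *)
(* Finite-dimensional Hilbert spaces are C^d (standard
   orthonormal basis) for C : numClosedFieldType; operators are MathComp
   matrices; tensor products are Kronecker products (mxtens from
   mathcomp-real-closed), with C^a (x) C^b = C^(a*b) indexed by
   mxtens_index (i, j). *)
From HB Require Import structures.
From mathcomp Require Import all_boot all_order all_algebra.
From mathcomp Require Export mxtens.
Set Implicit Arguments. Unset Strict Implicit. Unset Printing Implicit Defensive.
Import GRing.Theory Num.Theory.
Local Open Scope ring_scope.

Section QDefs.
Variable C : numClosedFieldType.

(* hermitian adjoint *)
Definition adjmx p q (A : 'M[C]_(p, q)) : 'M[C]_(q, p) :=
  (map_mx (fun z => z^*) A)^T.

(* positive semidefinite: <v, A v> >= 0 for all v *)
Definition psdmx p (A : 'M[C]_p) : Prop :=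
  forall v : 'cV[C]_p, 0 <= (adjmx v *m A *m v) 0 0.

(* elements of the multi-matrix algebra  (+)_{i<k} B(C^(d i)) *)
Definition mmalg k (d : 'I_k -> nat) := forall i : 'I_k, 'M[C]_(d i).

(* a linear map (+)_i B(C^(da i)) -> (+)_j B(C^(db j)) given by its
   components F i j : B(C^(da i)) -> B(C^(db j)) *)
Definition mmap k l (da : 'I_k -> nat) (db : 'I_l -> nat) :=
  forall (i : 'I_k) (j : 'I_l), 'M[C]_(da i) -> 'M[C]_(db j).

Definition mapply k l (da : 'I_k -> nat) (db : 'I_l -> nat)
  (F : mmap da db) (rho : mmalg da) : mmalg db :=
  fun j => \sum_(i < k) F i j (rho i).

Definition mtrace k (d : 'I_k -> nat) (rho : mmalg d) : C :=
  \sum_(i < k) \tr (rho i).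

Definition mpsd k (d : 'I_k -> nat) (rho : mmalg d) : Prop :=
  forall i, psdmx (rho i).

Definition linmx p q (f : 'M[C]_p -> 'M[C]_q) : Prop :=
  forall (a : C) (A B : 'M[C]_p), f (a *: A + B) = a *: f A + f B.

(* block (a,b) of Z in B(C^r (x) C^p) = M_r (x) B(C^p) *)
Definition blockL r p (Z : 'M[C]_(r * p)) (a b : 'I_r) : 'M[C]_p :=
  \matrix_(u, v) Z (mxtens_index (a, u)) (mxtens_index (b, v)).

(* id_{M_r} (x) f *)
Definition ampL r p q (f : 'M[C]_p -> 'M[C]_q) (Z : 'M[C]_(r * p)) : 'M[C]_(r * q) :=
  \sum_(a < r) \sum_(b < r) (delta_mx a b *t f (blockL Z a b)).
Arguments ampL r {p q}.

(* block (a,b) of Z in B(C^p (x) C^r) = B(C^p) (x) M_r *)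
Definition blockR p r (Z : 'M[C]_(p * r)) (a b : 'I_r) : 'M[C]_p :=
  \matrix_(u, v) Z (mxtens_index (u, a)) (mxtens_index (v, b)).

(* f (x) id_{M_r} *)
Definition ampR r p q (f : 'M[C]_p -> 'M[C]_q) (Z : 'M[C]_(p * r)) : 'M[C]_(q * r) :=
  \sum_(a < r) \sum_(b < r) (f (blockR Z a b) *t delta_mx a b).
Arguments ampR r {p q}.

(* id_{M_r} (x) F on  M_r (x) (+)_i B(C^(da i)) = (+)_i B(C^r (x) C^(da i)) *)
Definition mampL k l (da : 'I_k -> nat) (db : 'I_l -> nat) r (F : mmap da db) :
  mmap (fun i => r * da i)%N (fun j => r * db j)%N :=
  fun i j => ampL r (F i j).
Arguments mampL {k l da db} r.

(* channel = linear, completely positive, trace preserving *)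
Definition channel k l (da : 'I_k -> nat) (db : 'I_l -> nat) (F : mmap da db) : Prop :=
  [/\ forall i j, linmx (F i j),
      forall r (rho : mmalg (fun i => r * da i)%N), mpsd rho -> mpsd (mapply (mampL r F) rho)
    & forall rho : mmalg da, mtrace (mapply F rho) = mtrace rho].

(* rho (x) W in B(C^p (x) C^h1 (x) C^h2), as an operator on (C^p (x) C^h1) (x) C^h2 *)
Definition tens3 p h1 h2 (rho : 'M[C]_p) (W : 'M[C]_(h1 * h2)) : 'M[C]_((p * h1) * h2) :=
  \matrix_(u, v)
    (rho (mxtens_unindex (mxtens_unindex u).1).1 (mxtens_unindex (mxtens_unindex v).1).1 *
     W (mxtens_index ((mxtens_unindex (mxtens_unindex u).1).2, (mxtens_unindex u).2))
       (mxtens_index ((mxtens_unindex (mxtens_unindex v).1).2, (mxtens_unindex v).2))).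

(* (F (x) id_{B(C^h2)}) (rho (x) W), for F : A (x) B(C^h1) -> B *)
Definition ext_apply k l (da : 'I_k -> nat) (db : 'I_l -> nat) h1 h2
  (F : mmap (fun i => da i * h1)%N db) (W : 'M[C]_(h1 * h2)) (rho : mmalg da) :
  mmalg (fun j => db j * h2)%N :=
  fun j => \sum_(i < k) ampR h2 (F i j) (tens3 (rho i) W).

(* swap W' in B(C^h2 (x) C^h1) of W in B(C^h1 (x) C^h2) *)
Definition swapmx h1 h2 (W : 'M[C]_(h1 * h2)) : 'M[C]_(h2 * h1) :=
  \matrix_(u, v) W (mxtens_index ((mxtens_unindex u).2, (mxtens_unindex u).1))
                   (mxtens_index ((mxtens_unindex v).2, (mxtens_unindex v).1)).

(* entanglement-invertibility of M : A (x) B(H1) -> B w.r.t. W on H1 (x) H2 *)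
Definition ent_invertible k l (da : 'I_k -> nat) (db : 'I_l -> nat) h1 h2
  (M : mmap (fun i => da i * h1)%N db) (W : 'M[C]_(h1 * h2)) : Prop :=
  exists N : mmap (fun j => db j * h2)%N da,
    [/\ channel N,
        forall rho : mmalg da, forall i, mapply N (ext_apply M W rho) i = rho i
      & forall sigma : mmalg db, forall j, mapply M (ext_apply N (swapmx W) sigma) j = sigma j].

(* |w_omega> = sum_a |a> (x) omega |a> *)
Definition wvec h (om : 'M[C]_h) : 'cV[C]_(h * h) :=
  \col_u om (mxtens_unindex u).2 (mxtens_unindex u).1.

(* W_omega = |w_omega><w_omega| *)
Definition Wom h (om : 'M[C]_h) : 'M[C]_(h * h) := wvec om *m adjmx (wvec om).

(* Phi_H = |eta_H><eta_H| / dim H *)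
Definition PhiH h : 'M[C]_(h * h) :=
  (h%:R)^-1 *: (wvec (1%:M : 'M[C]_h) *m adjmx (wvec (1%:M : 'M[C]_h))).

(* partial trace over the second tensor factor *)
Definition ptr2 a b (Z : 'M[C]_(a * b)) : 'M[C]_a :=
  \matrix_(u, v) \sum_(t < b) Z (mxtens_index (u, t)) (mxtens_index (v, t)).

(* (1 (x) <e_t|) T  for T : C^p -> C^q (x) C^r *)
Definition braE p q r (T : 'M[C]_(q * r, p)) (t : 'I_r) : 'M[C]_(q, p) :=
  \matrix_(u, v) T (mxtens_index (u, t)) v.

(* tau i j : X_i (x) H -> Y_j (x) E_ji (dim E_ji = e j i) is a minimal
   dilation of M *)
Definition minimal_dilation k l (da : 'I_k -> nat) (db : 'I_l -> nat)
  (M : mmap da db) (e : 'I_l -> 'I_k -> nat)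
  (tau : forall i j, 'M[C]_(db j * e j i, da i)) : Prop :=
  (forall i j (rho : 'M[C]_(da i)), M i j rho = ptr2 (tau i j *m rho *m adjmx (tau i j))) /\
  (forall i j (c : 'I_(e j i) -> C),
      \sum_(t < e j i) c t *: braE (tau i j) t = 0 -> forall t, c t = 0).

(* rho1 is a self-intertwiner of M (w.r.t. the dilation tau) *)
Definition self_intertwiner k l (x : 'I_k -> nat) (y : 'I_l -> nat) h
  (e : 'I_l -> 'I_k -> nat) (tau : forall i j, 'M[C]_(y j * e j i, x i * h))
  (rho1 : 'M[C]_h) : Prop :=
  exists g : forall i j, 'M[C]_(e j i),
    forall i j, tau i j *m (1%:M *t rho1) = (1%:M *t g i j) *m tau i j.

End QDefs.

Arguments minimal_dilation {C k l da db} M e tau.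
Arguments self_intertwiner {C k l x y h} e tau rho1.

(* Main.v *)
Require Import Defs.
From HB Require Import structures.
From mathcomp Require Import all_boot all_order all_algebra.
From mathcomp Require Import mxtens.
From mathcomp Require Import ring.
Import GRing.Theory Num.Theory.
Local Open Scope ring_scope.

(* Let [K] be the Kraus operators of [M], with [H]-slices [k_a = K (1 (x) |a>)],
   and [L], [l_b] those of a candidate inverse [N] (Choi).  All Kraus operators
   of an identity channel are scalar, so invertibility with respect to [W_om]
   says that [sum_ab om_ba l_b k_a] and [sum_ab om_ba k_a l_b] are scalar on the
   diagonal blocks and zero off them.  Since [L] and [K] are isometric, this
   yields [sum_a om_ba k_a = sum_s lam_s l_b^*] and [sum_b om_ba l_b =
   sum_t mu_t k_a^*].  Combining the two, [rho_1] intertwines [tau] with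
   [g = lam mu^*].  By minimality [g], hence [mu], can be cancelled, and the
   scalar equations become statements on [k] alone that do not mention [om]: both
   [tau] and its transpose on [H] are unitary up to scaling (biunitarity).
   Conversely, given biunitarity and [g], a factorisation
   [(dim X_i / dim Y_j) g = mu mu^*] defines [l] by the second formula, and the
   resulting [N] inverts [M] with respect to [W_om].  Both directions of the
   theorem follow, because [Phi_H] is [W_om] for [om] the multiple [1 / sqrt h]
   of the identity, for which an intertwiner always exists. *)

Section EntanglementInvertibility.
Set Implicit Arguments.
Unset Strict Implicit.
Unset Printing Implicit Defensive.
Variable C : numClosedFieldType.
Implicit Types p q r h : nat.

(** * Adjoints and positive semidefinite matrices *)

Lemma adjmxE p q (A : 'M[C]_(p, q)) i j : adjmx A i j = (A j i)^*.
Proof. by rewrite !mxE. Qed.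

Lemma adjmxK p q : cancel (@adjmx C p q) (@adjmx C q p).
Proof. by move=> A; apply/matrixP => i j; rewrite !adjmxE conjCK. Qed.

Lemma adjmx0 p q : adjmx (0 : 'M[C]_(p, q)) = 0.
Proof. by apply/matrixP => i j; rewrite adjmxE !mxE conjC0. Qed.

Lemma adjmxD p q (A B : 'M[C]_(p, q)) : adjmx (A + B) = adjmx A + adjmx B.
Proof. by rewrite /adjmx map_mxD linearD. Qed.

Lemma adjmxZ p q c (A : 'M[C]_(p, q)) : adjmx (c *: A) = c^* *: adjmx A.
Proof. by rewrite /adjmx map_mxZ linearZ. Qed.

Lemma adjmx_sum p q (I : Type) (s : seq I) (P : pred I) (F : I -> 'M[C]_(p, q)) :
  adjmx (\sum_(i <- s | P i) F i) = \sum_(i <- s | P i) adjmx (F i).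
Proof. exact: (big_morph _ (@adjmxD p q) (adjmx0 p q)). Qed.

Lemma adjmxM p q r (A : 'M[C]_(p, q)) (B : 'M_(q, r)) :
  adjmx (A *m B) = adjmx B *m adjmx A.
Proof. by rewrite /adjmx map_mxM trmx_mul. Qed.

Lemma adjmx_scalar p c : adjmx (c%:M : 'M[C]_p) = (c^*)%:M.
Proof. by rewrite /adjmx map_scalar_mx tr_scalar_mx. Qed.

Lemma adjmx_delta p (i : 'I_p) :
  adjmx (delta_mx i (0 : 'I_1)) = delta_mx 0 i :> 'M[C]__.
Proof. by apply/matrixP => k l; rewrite adjmxE !mxE andbC conjC_nat. Qed.

Lemma adjmx_unitary p (A : 'M[C]_p) : A \is unitarymx -> invmx A = adjmx A.
Proof. by move=> /invmx_unitary ->; rewrite /adjmx map_trmx. Qed.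

Lemma mxtrace_mul_delta p (A : 'M[C]_p) a b : \tr (A *m delta_mx b a) = A a b.
Proof.
rewrite /mxtrace (bigD1 a) //= mxE (bigD1 b) //= mxE !eqxx mulr1.
rewrite !big1 ?addr0 // => [i ne_ia|i ne_ib].
  by rewrite mxE big1 // => j _; rewrite mxE (negPf ne_ia) andbF mulr0.
by rewrite mxE (negPf ne_ib) mulr0.
Qed.

Lemma sandwichE p q (V : 'M[C]_(q, p)) (A : 'M_p) u w :
  (V *m A *m adjmx V) u w = \sum_a \sum_b V u a * A a b * (V w b)^*.
Proof.
rewrite mxE exchange_big; apply: eq_bigr => b _.
by rewrite mxE mulr_suml; apply: eq_bigr => a _; rewrite adjmxE.
Qed.

Lemma sandwich_delta p q (V : 'M[C]_(q, p)) a b u w :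
  (V *m delta_mx a b *m adjmx V) u w = V u a * (V w b)^*.
Proof.
rewrite sandwichE (bigD1 a) //= (bigD1 b) //= mxE !eqxx mulr1.
rewrite !big1 ?addr0 // => [i ne_ia|i ne_ib].
  by apply: big1 => j _; rewrite mxE (negPf ne_ia) mulr0 mul0r.
by rewrite mxE (negPf ne_ib) andbF mulr0 mul0r.
Qed.

Lemma psdmx_sandwich p q (V : 'M[C]_(q, p)) (A : 'M_p) :
  psdmx A -> psdmx (V *m A *m adjmx V).
Proof.
move=> Apsd v; have := Apsd (adjmx V *m v).
by rewrite adjmxM adjmxK !mulmxA.
Qed.

Lemma psdmx_sum p (I : Type) (s : seq I) (P : pred I) (F : I -> 'M[C]_p) :
  (forall i, P i -> psdmx (F i)) -> psdmx (\sum_(i <- s | P i) F i).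
Proof.
move=> Fpsd v; rewrite mulmx_sumr mulmx_suml summxE.
by apply: sumr_ge0 => i /Fpsd.
Qed.

Lemma psdmx_gram p q (B : 'M[C]_(p, q)) : psdmx (B *m adjmx B).
Proof.
move=> v; rewrite mulmxA -mulmxA -[B in adjmx v *m B]adjmxK -adjmxM mxE.
by apply: sumr_ge0 => i _; rewrite adjmxE mulrC mul_conjC_ge0.
Qed.

(** Polarisation: the form at [e_a + c e_b], with [c = 1] and [c = 'i], shows that [A a b + A b a]
    and ['i * (A a b - A b a)] are real. *)
Lemma psdmx_hermitian p (A : 'M[C]_p) : psdmx A -> adjmx A = A.
Proof.
move=> Apsd; apply/matrixP => a b; rewrite adjmxE.
have form (i j : 'I_p) :
    \tr (adjmx (delta_mx i (0 : 'I_1)) *m A *m delta_mx j (0 : 'I_1)) = A i j.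
  by rewrite adjmx_delta -rowE -colE trace_mx11 !mxE.
have real_diag (i : 'I_p) : A i i \is Num.real.
  by rewrite -form trace_mx11 realE Apsd.
have real_off c : c * A a b + c^* * A b a + c^* * c * A b b \is Num.real.
  have := Apsd (delta_mx a 0 + c *: delta_mx b 0).
  rewrite -trace_mx11 adjmxD adjmxZ !(mulmxDl, mulmxDr) => /ger0_real.
  rewrite -!(scalemxAl, scalemxAr) !(mxtraceD, mxtraceZ) !form.
  rewrite -addrA => /rpredB /(_ (real_diag a)).
  rewrite [_ - _]addrC !addrA addNr add0r mulrA.
  by rewrite [c^* * _ + _]addrC.
have real_off2 c : c^* * c \is Num.real -> c * A a b + c^* * A b a \is Num.real.
  move=> rc; have := rpredB (real_off c) (rpredM rc (real_diag b)).
  by rewrite addrK.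
have := real_off2 1; rewrite conjC1 !mul1r => /(_ (rpred1 _)) /CrealP.
rewrite rmorphD /= => e1.
have := real_off2 'i; rewrite conjCi mulNr -expr2 sqrCi opprK.
move=> /(_ (rpred1 _)) /CrealP; rewrite mulNr rmorphB !rmorphM /= conjCi.
rewrite !mulNr opprK -[- ('i * _)]mulrN -[_ - 'i * _]addrC -mulrN -!mulrDr.
move/(mulfI (neq0Ci _)) => e2.
have /(mulfI (_ : 2%:R != 0)) : 2%:R * (A b a)^* = 2%:R * A a b.
  rewrite !mulr_natl !mulr2n; have := congr2 +%R e1 e2.
  by rewrite addrACA subrr add0r addrA addrK.
by apply; rewrite pnatr_eq0.
Qed.

(** Spectral theorem: the eigenvalues are values of the form, hence nonnegative, and their square
    roots give [B]. *)
Lemma psdmx_factor p (A : 'M[C]_p) :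
  psdmx A -> exists B : 'M[C]_p, A = B *m adjmx B.
Proof.
move=> Apsd; have Ah := psdmx_hermitian Apsd.
have /orthomx_spectralP : A \is normalmx.
  by apply/normalmxP; rewrite -map_trmx -/(adjmx A) Ah.
have := spectral_unitarymx A; set P := spectralmx A; set D := spectral_diag A.
move=> Pu; rewrite adjmx_unitary // => defA.
have PK : P *m adjmx P = 1%:M.
  by rewrite -adjmx_unitary // mulmxV // unitarymx_unit.
have diagA : P *m A *m adjmx P = diag_mx D.
  by rewrite defA !mulmxA PK mul1mx -mulmxA PK mulmx1.
have D_ge0 i : 0 <= D 0 i.
  have := psdmx_sandwich P Apsd (delta_mx i 0); rewrite diagA.
  by rewrite adjmx_delta -rowE -colE !mxE eqxx.
exists (adjmx P *m diag_mx (map_mx sqrtC D)).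
rewrite adjmxM adjmxK mulmxA {1}defA; congr (_ *m _); rewrite -mulmxA.
congr (_ *m _); apply/matrixP => i j; rewrite mul_diag_mx !mxE.
case: eqVneq => [->|_]; last first.
  by rewrite !mulr0n conjC0 mulr0.
by rewrite !mulr1n conj_Creal ?ger0_real ?sqrtC_ge0 // -expr2 sqrtCK.
Qed.

(** * Kraus operators and partially contracted channels *)

Lemma big_mxtens (V : nmodType) p q (F : 'I_(p * q) -> V) :
  \sum_i F i = \sum_(a < p) \sum_(b < q) F (mxtens_index (a, b)).
Proof.
rewrite pair_big /= (reindex (@mxtens_index p q)) /=; last first.
  by exists (@mxtens_unindex p q) => i _; rewrite ?mxtens_indexK ?mxtens_unindexK.
by apply: eq_bigr => -[a b].
Qed.

Definition kraus p q f (V : 'I_f -> 'M[C]_(q, p)) (rho : 'M[C]_p) : 'M[C]_q :=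
  \sum_s V s *m rho *m adjmx (V s).

Lemma kraus_linmx p q f (V : 'I_f -> 'M[C]_(q, p)) : linmx (kraus V).
Proof.
move=> a A B; rewrite /kraus scaler_sumr -big_split; apply: eq_bigr => s _ /=.
by rewrite mulmxDr mulmxDl -scalemxAr -scalemxAl.
Qed.

Lemma linmx0 p q (f : 'M[C]_p -> 'M[C]_q) : linmx f -> f 0 = 0.
Proof.
move=> fl; have := fl 1 0 0; rewrite !scale1r addr0 => /eqP.
by rewrite -subr_eq0 opprD addrA subrr add0r oppr_eq0 => /eqP.
Qed.

Lemma linmx_sum_delta p q (f : 'M[C]_p -> 'M[C]_q) (A : 'M[C]_p) : linmx f ->
  f A = \sum_a \sum_b A a b *: f (delta_mx a b).
Proof.
move=> fl; have f0 := linmx0 fl.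
have fD B D : f (B + D) = f B + f D by rewrite -[B]scale1r fl !scale1r.
rewrite {1}[A]matrix_sum_delta (big_morph f fD f0); apply: eq_bigr => a _.
rewrite (big_morph f fD f0); apply: eq_bigr => b _.
by rewrite -[_ *: _]addr0 fl f0 addr0.
Qed.

Lemma ampLE r p q (f : 'M[C]_p -> 'M[C]_q) (Z : 'M[C]_(r * p)) a b u w :
  ampL f Z (mxtens_index (a, u)) (mxtens_index (b, w)) = f (blockL Z a b) u w.
Proof.
rewrite /ampL summxE (bigD1 a) //= summxE (bigD1 b) //= tensmxE mxE !eqxx mul1r.
rewrite big1 ?addr0 => [|j ne_jb]; last first.
  by rewrite tensmxE mxE [b == j]eq_sym (negPf ne_jb) andbF mul0r.
rewrite big1 ?addr0 // => i ne_ia; rewrite summxE big1 // => j _.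
by rewrite tensmxE mxE [a == i]eq_sym (negPf ne_ia) mul0r.
Qed.

Lemma ampRE p r q (f : 'M[C]_p -> 'M[C]_q) (Z : 'M[C]_(p * r)) a b u w :
  ampR f Z (mxtens_index (u, a)) (mxtens_index (w, b)) = f (blockR Z a b) u w.
Proof.
rewrite /ampR summxE (bigD1 a) //= summxE (bigD1 b) //= tensmxE mxE !eqxx mulr1.
rewrite big1 ?addr0 => [|j ne_jb]; last first.
  by rewrite tensmxE [delta_mx _ _ _ _]mxE [b == j]eq_sym (negPf ne_jb) andbF mulr0.
rewrite big1 ?addr0 // => i ne_ia; rewrite summxE big1 // => j _.
by rewrite tensmxE [delta_mx _ _ _ _]mxE [a == i]eq_sym (negPf ne_ia) mulr0.
Qed.

Lemma ampL_kraus r p q f (V : 'I_f -> 'M[C]_(q, p)) (Z : 'M[C]_(r * p)) :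
  ampL (kraus V) Z = kraus (fun s => 1%:M *t V s) Z.
Proof.
apply/matrixP => u w; case: (mxtens_indexP u) => a u'.
case: (mxtens_indexP w) => b w'; rewrite ampLE !summxE; apply: eq_bigr => s _.
(* [1 (x) V s] is block diagonal, so a sum against its row [(c, v)] reduces to block [c]. *)
have pick (c : 'I_r) (v : 'I_q) (F : C -> 'I_(r * p) -> C) :
    (forall d, F 0 d = 0) ->
    \sum_d F ((1%:M *t V s) (mxtens_index (c, v)) d) d =
    \sum_e F (V s v e) (mxtens_index (c, e)).
  move=> F0; rewrite big_mxtens (bigD1 c) //= [X in _ + X]big1 ?addr0.
    by apply: eq_bigr => e _; rewrite tensmxE mxE eqxx mul1r.
  move=> d ne_dc; apply: big1 => e _.
  by rewrite tensmxE mxE eq_sym (negPf ne_dc) mul0r F0.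
rewrite !sandwichE (pick a u' (fun z d => \sum_d' z * Z d d' *
  ((1%:M *t V s) (mxtens_index (b, w')) d')^*)) => [|d]; last first.
  by apply: big1 => d' _; rewrite !mul0r.
apply: eq_bigr => c _.
rewrite (pick b w' (fun z d => V s u' c * Z (mxtens_index (a, c)) d * z^*)).
  by apply: eq_bigr => d _; rewrite mxE.
by move=> d; rewrite conjC0 mulr0.
Qed.

Lemma kraus_psdmx p q f (V : 'I_f -> 'M[C]_(q, p)) rho :
  psdmx rho -> psdmx (kraus V rho).
Proof. by move=> rho_psd; apply: psdmx_sum => s _; apply: psdmx_sandwich. Qed.

(** * Slices along [H] and contraction with [w_om] *)

Definition slice p q h (K : 'M[C]_(q, p * h)) (a : 'I_h) : 'M[C]_(q, p) :=
  \matrix_(u, v) K u (mxtens_index (v, a)).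

Definition unslice p q h (k : 'I_h -> 'M[C]_(q, p)) : 'M[C]_(q, p * h) :=
  \matrix_(u, v) k (mxtens_unindex v).2 u (mxtens_unindex v).1.

Lemma unsliceK p q h (k : 'I_h -> 'M[C]_(q, p)) a : slice (unslice k) a = k a.
Proof. by apply/matrixP => u v; rewrite !mxE mxtens_indexK. Qed.

Lemma slice_gram p q h (K : 'M[C]_(q, p * h)) a b u v :
  (adjmx (slice K a) *m slice K b) u v =
  (adjmx K *m K) (mxtens_index (u, a)) (mxtens_index (v, b)).
Proof. by rewrite !mxE; apply: eq_bigr => c _; rewrite !adjmxE !mxE. Qed.

(** The [<b|]-component of [sum_a k_a (x) om |a>]: what remains of [K] once its [H] input is fed
    with the first half of [w_om]. *)
Definition twist p q h (om : 'M[C]_h) (k : 'I_h -> 'M[C]_(q, p)) (b : 'I_h) :=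
  \sum_a om b a *: k a.

Lemma twist_contract p q r h (om : 'M[C]_h) (k : 'I_h -> 'M[C]_(q, p))
    (l : 'I_h -> 'M[C]_(r, q)) :
  \sum_b l b *m twist om k b = \sum_a twist om^T l a *m k a.
Proof.
under eq_bigr do rewrite mulmx_sumr; rewrite exchange_big.
apply: eq_bigr => a _; rewrite mulmx_suml; apply: eq_bigr => b _.
by rewrite mxE -scalemxAl -scalemxAr.
Qed.

(* [(K (x) 1) (1 (x) |w_om>)] *)
Definition bend p q h (om : 'M[C]_h) (K : 'M[C]_(q, p * h)) : 'M[C]_(q * h, p) :=
  \matrix_(u, v) twist om (slice K) (mxtens_unindex u).2 (mxtens_unindex u).1 v.

Lemma mul_bend p q r h (om : 'M[C]_h) (K : 'M[C]_(q, p * h)) (L : 'M_(r, q * h)) :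
  L *m bend om K = \sum_b slice L b *m twist om (slice K) b.
Proof.
apply/matrixP => u v; rewrite mxE big_mxtens summxE exchange_big.
apply: eq_bigr => b _; rewrite mxE; apply: eq_bigr => c _.
by rewrite !mxE mxtens_indexK.
Qed.

(** [W_om] has rank one, so tensoring with it is conjugation by [1 (x) |w_om>], which is absorbed
    into each Kraus operator. *)
Lemma ampR_kraus p q h f (om : 'M[C]_h) (K : 'I_f -> 'M[C]_(q, p * h)) rho :
  ampR (kraus K) (tens3 rho (Wom om)) = kraus (fun t => bend om (K t)) rho.
Proof.
apply/matrixP => u w; case: (mxtens_indexP u) => u' b.
case: (mxtens_indexP w) => w' b'; rewrite ampRE !summxE; apply: eq_bigr => t _.
rewrite !sandwichE big_mxtens; apply: eq_bigr => x _.
under eq_bigr do rewrite big_mxtens; rewrite exchange_big.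
apply: eq_bigr => x' _; rewrite !mxE !mxtens_indexK /= !summxE rmorph_sum.
rewrite -mulrA mulr_suml; apply: eq_bigr => a _; rewrite !mulr_sumr.
apply: eq_bigr => a' _; rewrite !mxE !mxtens_indexK /= big_ord1 !mxE.
by rewrite !mxtens_indexK !rmorphM /=; ring.

Qed.

Lemma swapmx_Wom h (om : 'M[C]_h) : swapmx (Wom om) = Wom om^T.
Proof.
by apply/matrixP => u v; rewrite !mxE !big_ord1 !mxE !mxtens_indexK.
Qed.

Lemma mapply_single k l (da : 'I_k -> nat) (db : 'I_l -> nat)
    (F : mmap C da db) i (A : 'M[C]_(da i)) j :
    (forall i', linmx (F i' j)) ->
  mapply F (dfwith (fun=> 0) A) j = F i j A.
Proof.
move=> Fl; rewrite /mapply (bigD1 i) //= dfwith_in big1 ?addr0 // => i' ne_i'i.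
by rewrite dfwith_out ?linmx0 // eq_sym.
Qed.

(** * Kraus families of channels between multi-matrix algebras *)

Section Families.
Variables (k l : nat) (da : 'I_k -> nat) (db : 'I_l -> nat).

(* Choi's theorem *)
Lemma channel_kraus (F : mmap C da db) : channel F ->
  exists V : forall i j, 'I_(da i * db j) -> 'M[C]_(db j, da i),
    forall i j rho, F i j rho = kraus (V i j) rho.
Proof.
case=> Flin Fcp _.
apply: (@fin_all_exists _ (fun i => forall j, 'I_(da i * db j) -> 'M_(db j, da i))
  (fun i V => forall j rho, F i j rho = kraus (V j) rho)) => i.
apply: (@fin_all_exists _ (fun j => 'I_(da i * db j) -> 'M_(db j, da i))
  (fun j V => forall rho, F i j rho = kraus V rho)) => j.
(* The unnormalised maximally entangled vector; its projector is sent to the Choi matrix of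
   [F i j]. *)
pose w : 'cV[C]_(da i * da i) :=
  \col_u ((mxtens_unindex u).1 == (mxtens_unindex u).2)%:R.
have /psdmx_factor[B defB] : psdmx (ampL (F i j) (w *m adjmx w)).
  have := @Fcp (da i) (dfwith (fun=> 0) (w *m adjmx w)).
  have linL i' j' : linmx (@mampL C k l da db (da i) F i' j').
    move=> c A D; rewrite /mampL; apply/matrixP => u v.
    case: (mxtens_indexP u) => a u'; case: (mxtens_indexP v) => b v'.
    rewrite !mxE !ampLE; have -> : blockL (c *: A + D) a b =
      c *: blockL A a b + blockL D a b by apply/matrixP => s t; rewrite !mxE.
    by rewrite Flin !mxE.
  rewrite /mpsd => psdF; have := psdF _ j; rewrite mapply_single //; apply.
  move=> i'; case: dfwithP => [|? _]; first exact: psdmx_gram.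
  by move=> v; rewrite mulmx0 mul0mx mxE.
(* The columns of [B], reshaped into matrices, are the Kraus operators. *)
exists (fun s => \matrix_(u, a) B (mxtens_index (a, u)) s) => rho.
rewrite (linmx_sum_delta _ (Flin i j)).
rewrite [RHS](linmx_sum_delta _ (kraus_linmx _)).
apply: eq_bigr => a _; apply: eq_bigr => b _; congr (_ *: _).
apply/matrixP => u v; have := congr1
  (fun A : 'M_(_) => A (mxtens_index (a, u)) (mxtens_index (b, v))) defB.
rewrite /= ampLE; have -> : blockL (w *m adjmx w) a b = delta_mx a b.
  apply/matrixP => s t; rewrite !mxE big_ord1 !mxE !mxtens_indexK /= conjC_nat.
  by rewrite -natrM mulnb ![_ == a]eq_sym ![_ == b]eq_sym.
move=> ->; rewrite mxE summxE; apply: eq_bigr => s _.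
by rewrite sandwich_delta adjmxE !mxE.
Qed.

Variables (f : 'I_k -> 'I_l -> nat).
Variables (V : forall i j, 'I_(f i j) -> 'M[C]_(db j, da i)).
Arguments V : clear implicits.

(** Trace preservation, tested on the matrix unit [delta_mx b a] placed in block [i], is the
    [(a, b)] entry of this identity. *)
Lemma channel_gram (F : mmap C da db) :
    channel F -> (forall i j rho, F i j rho = kraus (V i j) rho) ->
  forall i, \sum_j \sum_s adjmx (V i j s) *m V i j s = 1%:M.
Proof.
case=> Flin _ Ftr FV i; apply/matrixP => a b.
have := Ftr (dfwith (fun=> 0) (delta_mx b a : 'M[C]_(da i))).
rewrite /mtrace (eq_bigr (fun j => \tr (F i j (delta_mx b a)))); last first.
  by move=> j _; rewrite mapply_single.
rewrite [in RHS](bigD1 i) //= dfwith_in [X in _ = _ + X]big1 ?addr0; last first.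
  by move=> i' ne_i'i; rewrite dfwith_out ?mxtrace0 // eq_sym.
rewrite -{2}[delta_mx b a]mul1mx mxtrace_mul_delta => <-.
rewrite summxE; apply: eq_bigr => j _; rewrite FV /kraus raddf_sum summxE.
by apply: eq_bigr => s _; rewrite /= mxtrace_mulC mulmxA mxtrace_mul_delta.
Qed.

Lemma kraus_channel :
    (forall i, \sum_j \sum_s adjmx (V i j s) *m V i j s = 1%:M) ->
  channel (fun i j => kraus (V i j)).
Proof.
move=> Vgram; split=> [i j|r rho rho_psd j|rho]; first exact: kraus_linmx.
  apply: psdmx_sum => i _; rewrite /mampL ampL_kraus; exact: kraus_psdmx.
rewrite /mtrace /mapply; under eq_bigr do rewrite raddf_sum.
rewrite exchange_big; apply: eq_bigr => i _.
rewrite -{2}[rho i]mul1mx -(Vgram i) mulmx_suml raddf_sum; apply: eq_bigr => j _.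
rewrite mulmx_suml !raddf_sum; apply: eq_bigr => s _ /=.
by rewrite mxtrace_mulC mulmxA.
Qed.

End Families.

(** At the input [delta_mx a a], the entry [(u, u)] of the output is a sum of the nonnegative terms
    [|V s u a|^2]. *)
Lemma kraus_eq0 (S : finType) p q (V : S -> 'M[C]_(q, p)) :
  (forall rho, \sum_s V s *m rho *m adjmx (V s) = 0) -> forall s, V s = 0.
Proof.
move=> V0 s; apply/matrixP => u a; rewrite mxE; apply/eqP.
have := congr1 (fun A : 'M_(_) => A u u) (V0 (delta_mx a a)).
rewrite /= summxE mxE => /psumr_eq0P H; have := H _ s isT.
rewrite sandwich_delta => {}H; rewrite -mul_conjC_eq0; apply/eqP/H => t _.
by rewrite sandwich_delta mul_conjC_ge0.
Qed.

(** The normalised trace names the scalar explicitly, so families of scalars can be defined without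
    choice. *)
Lemma scalar_mx_trace p (A : 'M[C]_p) (c : C) :
  A = c%:M -> A = ((p%:R)^-1 * \tr A)%:M.
Proof.
move=> ->; apply/matrixP => i j; rewrite mxtrace_scalar -[c *+ p]mulr_natl mulKf //.
by rewrite pnatr_eq0 -lt0n (leq_ltn_trans _ (ltn_ord i)).
Qed.

(* The identity channel is extremal: all its Kraus operators are scalar. *)
Lemma kraus_id (S : finType) p (V : S -> 'M[C]_p) :
    (forall rho, \sum_s V s *m rho *m adjmx (V s) = rho) ->
  forall s, V s = ((p%:R)^-1 * \tr (V s))%:M.
Proof.
move=> VI s.
have entry a b u w : \sum_s V s u a * (V s w b)^* = ((u == a) && (w == b))%:R.
  have := congr1 (fun A : 'M_(_) => A u w) (VI (delta_mx a b)).
  rewrite /= summxE mxE => <-; apply: eq_bigr => t _.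
  by rewrite sandwich_delta.
have offdiag u a : u != a -> V s u a = 0.
  move=> ne_ua; apply/eqP; rewrite -mul_conjC_eq0; apply/eqP.
  have := entry a a u u; rewrite (negPf ne_ua) => /psumr_eq0P; apply => // t _.
  exact: mul_conjC_ge0.
(* Summed over [s], the squared modulus of [V s a a - V s b b] expands to [1 - 1 - 1 + 1]. *)
have diag a b : V s a a = V s b b.
  apply/eqP; rewrite -subr_eq0 -mul_conjC_eq0; apply/eqP.
  suff /psumr_eq0P : \sum_s (V s a a - V s b b) * (V s a a - V s b b)^* = 0.
    by apply => // t _; apply: mul_conjC_ge0.
  under eq_bigr do rewrite rmorphB mulrBl !mulrBr.
  by rewrite !sumrB !entry !eqxx subrr.
case: (posnP p) => [p0|p_gt0].
  by apply/matrixP => i; have := ltn_ord i; rewrite {2}p0.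
apply: (@scalar_mx_trace _ _ (V s (Ordinal p_gt0) (Ordinal p_gt0))).
apply/matrixP => i j; rewrite mxE; case: eqVneq => [->|/offdiag] //.
by rewrite mulr1n; apply: diag.
Qed.

(** * Biunitarity from a pair of inverse isometries *)

Lemma scalar_mx_sum p (I : finType) (F : I -> C) :
  \sum_i (F i)%:M = (\sum_i F i)%:M :> 'M[C]_p.
Proof. by rewrite raddf_sum. Qed.

Lemma scalar_mx_inj d (b c : C) : (0 < d)%N -> b%:M = c%:M :> 'M_d -> b = c.
Proof.
by move=> d_gt0 /matrixP/(_ (Ordinal d_gt0) (Ordinal d_gt0)); rewrite !mxE eqxx.
Qed.

Lemma sum_delta (V : lmodType C) (I : finType) (i : I) (F : I -> V) :
  \sum_j (i == j)%:R *: F j = F i.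
Proof.
rewrite (bigD1 i) //= eqxx scale1r big1 ?addr0 // => j ne_ji.
by rewrite eq_sym (negPf ne_ji) scale0r.
Qed.

Lemma twistM p q h (A B : 'M[C]_h) (k : 'I_h -> 'M[C]_(q, p)) a :
  twist A (twist B k) a = twist (A *m B) k a.
Proof.
rewrite /twist; under eq_bigr do rewrite scaler_sumr.
rewrite exchange_big; apply: eq_bigr => b _; rewrite mxE scaler_suml.
by apply: eq_bigr => c _; rewrite scalerA.
Qed.

Lemma twist1 p q h (k : 'I_h -> 'M[C]_(q, p)) a : twist 1%:M k a = k a.
Proof. by rewrite /twist; under eq_bigr do rewrite mxE; apply: sum_delta. Qed.

Lemma eq_twist p q h (A : 'M[C]_h) (k k' : 'I_h -> 'M[C]_(q, p)) a :
  k =1 k' -> twist A k a = twist A k' a.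
Proof. by move=> e; apply: eq_bigr => b _; rewrite e. Qed.

Lemma twist_sum p q h (I : finType) (A : 'M[C]_h) (c : I -> C)
    (k : I -> 'I_h -> 'M[C]_(q, p)) a :
  twist A (fun b => \sum_t c t *: k t b) a = \sum_t c t *: twist A (k t) a.
Proof.
rewrite /twist; under eq_bigr do rewrite scaler_sumr.
rewrite exchange_big; apply: eq_bigr => t _; rewrite scaler_sumr.
by apply: eq_bigr => b _; rewrite !scalerA mulrC.
Qed.

Lemma adjmx_twist p q h (A : 'M[C]_h) (k : 'I_h -> 'M[C]_(q, p)) a :
  adjmx (twist A k a) = twist (map_mx Num.conj A) (fun b => adjmx (k b)) a.
Proof. by rewrite adjmx_sum; apply: eq_bigr => b _; rewrite adjmxZ mxE. Qed.

Section Families.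
Variables (m n h : nat) (p : 'I_m -> nat) (q : 'I_n -> nat).
Variables (e : 'I_m -> 'I_n -> nat) (f : 'I_n -> 'I_m -> nat).
Variable k : forall i j, 'I_(e i j) -> 'I_h -> 'M[C]_(q j, p i).
Variable l : forall j i, 'I_(f j i) -> 'I_h -> 'M[C]_(p i, q j).
Arguments k : clear implicits.
Arguments l : clear implicits.
Variables (om : 'M[C]_h) (lam : forall i j, 'I_(f j i) -> 'I_(e i j) -> C).
Arguments lam : clear implicits.

Definition isometric := forall i a b,
  \sum_j \sum_t adjmx (k i j t a) *m k i j t b = ((a == b)%:R)%:M.

(** These sums are the Kraus operators of the composite channel contracted with [w_om]: scalar from
    a block to itself, and zero between distinct blocks in [contract_offdiag]. *)
Definition contract_diag := forall i j s t,
  \sum_b l j i s b *m twist om (k i j t) b = (lam i j s t)%:M.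

Definition contract_offdiag := forall i i' j s t, i != i' ->
  \sum_b l j i' s b *m twist om (k i j t) b = 0.
End Families.

Arguments isometric {m n h p q e} k.
Arguments contract_diag {m n h p q e f} k l om lam.
Arguments contract_offdiag {m n h p q e f} k l om.

(* Since [l] comes from an isometry [L], [L K = lam] gives [K = L^* lam]. *)
Lemma contract_dual m n h (p : 'I_m -> nat) (q : 'I_n -> nat)
    (e : 'I_m -> 'I_n -> nat) (f : 'I_n -> 'I_m -> nat)
    (k : forall i j, 'I_(e i j) -> 'I_h -> 'M[C]_(q j, p i))
    (l : forall j i, 'I_(f j i) -> 'I_h -> 'M[C]_(p i, q j))
    (om : 'M[C]_h) (lam : forall i j, 'I_(f j i) -> 'I_(e i j) -> C) :
    isometric l -> contract_diag k l om lam -> contract_offdiag k l om ->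
  forall i j t b,
    twist om (k i j t) b = \sum_s lam i j s t *: adjmx (l j i s b).
Proof.
move=> l_iso kl_diag kl_off i j t b.
(* The isometry relation of [l] is inserted as an identity on the left; [kl_off] removes the blocks
   other than [i]. *)
rewrite -[LHS](sum_delta b (twist om (k i j t))).
under eq_bigr do rewrite -mul_scalar_mx -l_iso mulmx_suml.
rewrite exchange_big (bigD1 i) //= [X in _ + X]big1 ?addr0 => [|i' ne_i'i].
  under eq_bigr do rewrite mulmx_suml.
  rewrite exchange_big; apply: eq_bigr => s _.
  under eq_bigr do rewrite -mulmxA.
  by rewrite -mulmx_sumr kl_diag mul_mx_scalar.
under eq_bigr do rewrite mulmx_suml.
rewrite exchange_big big1 // => s _; under eq_bigr do rewrite -mulmxA.
by rewrite -mulmx_sumr kl_off ?mulmx0 // eq_sym.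
Qed.

(* The dilation assembled from [k] is unitary, and so is its partial transpose on
   [H] after scaling by [sqrt (p i / q j)]. *)
Record biunitary m n h (p : 'I_m -> nat) (q : 'I_n -> nat)
    (e : 'I_m -> 'I_n -> nat)
    (k : forall i j, 'I_(e i j) -> 'I_h -> 'M[C]_(q j, p i)) : Prop := Biunitary {
  biunitary_iso : isometric k;
  biunitary_coiso : forall i j t t',
    \sum_a k i j t a *m adjmx (k i j t' a) = ((t == t')%:R)%:M;
  biunitary_coiso0 : forall i j j' t t', j != j' ->
    \sum_a k i j' t a *m adjmx (k i j t' a) = 0;
  biunitary_trans : forall i j t t', \sum_a adjmx (k i j t a) *m k i j t' a =
    ((t == t')%:R * ((q j)%:R / (p i)%:R))%:M;
  biunitary_trans0 : forall i i' j t t', i != i' ->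
    \sum_a adjmx (k i' j t a) *m k i j t' a = 0;
  biunitary_cotrans : forall j b b',
    \sum_i \sum_t ((p i)%:R / (q j)%:R) *: (k i j t b *m adjmx (k i j t b')) =
      ((b == b')%:R)%:M
}.

(** * Relations on [k] alone extracted from the contraction equations *)

Section Structure.
Variables (m n h : nat) (p : 'I_m -> nat) (q : 'I_n -> nat).
Variables (e : 'I_m -> 'I_n -> nat) (f : 'I_n -> 'I_m -> nat).
Variable k : forall i j, 'I_(e i j) -> 'I_h -> 'M[C]_(q j, p i).
Variable l : forall j i, 'I_(f j i) -> 'I_h -> 'M[C]_(p i, q j).
Variables (om : 'M[C]_h) (lam : forall i j, 'I_(f j i) -> 'I_(e i j) -> C).
Variables (mu : forall j i, 'I_(e i j) -> 'I_(f j i) -> C).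
Arguments k : clear implicits.
Arguments l : clear implicits.
Arguments lam : clear implicits.
Arguments mu : clear implicits.
Hypotheses (k_iso : isometric k) (l_iso : isometric l).
Hypotheses (kl_diag : contract_diag k l om lam) (kl_off : contract_offdiag k l om).
Hypotheses (lk_diag : contract_diag l k om^T mu).
Hypotheses (lk_off : contract_offdiag l k om^T).
Hypothesis om_unit : om \in unitmx.
Hypothesis k_free : forall i j (c : 'I_(e i j) -> C),
  (forall a, \sum_t c t *: k i j t a = 0) -> forall t, c t = 0.

Let k_dual := contract_dual l_iso kl_diag kl_off.
Let l_dual := contract_dual k_iso lk_diag lk_off.

Definition intertwining i j : 'M[C]_(e i j) :=
  \matrix_(t, t') \sum_s lam i j s t * (mu j i t' s)^*.

(** [k_dual] replaces the twist of [k] by adjoints of [l], and the adjoint of [l_dual] leads back to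
    [k], since [adjmx om] is the conjugate of [om^T]. *)
Lemma twist_intertwining i j t a : twist (adjmx om *m om) (k i j t) a =
  \sum_t' intertwining i j t t' *: k i j t' a.
Proof.
rewrite -twistM (eq_twist _ _ (k_dual t)) twist_sum.
under [RHS]eq_bigr do rewrite mxE scaler_suml.
rewrite exchange_big; apply: eq_bigr => s _.
have -> : adjmx om = map_mx Num.conj om^T by rewrite /adjmx map_trmx.
rewrite -adjmx_twist l_dual adjmx_sum scaler_sumr; apply: eq_bigr => t' _.
by rewrite adjmxZ adjmxK scalerA.
Qed.

(** If [v] kills the intertwiner, the combination of [k] with coefficients [v] is killed by the
    invertible twist [adjmx om *m om], so [v = 0] by [k_free]. *)
Lemma intertwining_unit i j : intertwining i j \in unitmx.
Proof.
rewrite -row_free_unit; apply: inj_row_free => v vg0; apply/rowP => t.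
rewrite mxE; apply: k_free t => a.
have G_unit : adjmx om *m om \in unitmx.
  by rewrite unitmx_mul om_unit unitmx_tr map_unitmx om_unit.
rewrite -(twist1 (fun b => \sum_t v 0 t *: k i j t b)) -(mulVmx G_unit) -twistM.
apply: big1 => b _; rewrite twist_sum [X in _ *: X](_ : _ = 0) ?scaler0 //.
under eq_bigr do rewrite twist_intertwining scaler_sumr.
rewrite exchange_big big1 // => t' _; have /rowP/(_ t') := vg0.
by rewrite !mxE => g0; under eq_bigr do rewrite scalerA; rewrite -scaler_suml g0 scale0r.
Qed.

(** The sizes [f j i] and [e i j] may differ, so the inverse is one-sided. With [g] the intertwiner,
    [g^-1 lam mu^* = 1], and the adjoint of [g^-1 lam] serves as [nu]. *)
Lemma mu_right_inverse i j : exists nu : 'I_(f j i) -> 'I_(e i j) -> C,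
  forall t t', \sum_s mu j i t s * nu s t' = (t == t')%:R.
Proof.
pose L : 'M_(_, _) := \matrix_(t, s) lam i j s t.
pose U : 'M_(_, _) := \matrix_(t, s) mu j i t s.
have defg : intertwining i j = L *m adjmx U.
  by apply/matrixP => t t'; rewrite !mxE; apply: eq_bigr => s _; rewrite !mxE.
have := congr1 (@adjmx _ _ _) (mulVmx (intertwining_unit i j)).
rewrite {2}defg mulmxA adjmxM adjmxK adjmx_scalar conjC1 => /matrixP UN.
exists (adjmx (invmx (intertwining i j) *m L)) => t t'.
by have := UN t t'; rewrite !mxE => <-; apply: eq_bigr => s _; rewrite !mxE.
Qed.

(** Cancelling [mu] in [l_dual] makes [adjmx k] a combination of twisted [l]; the contraction
    equations then give relations on [k] in which [om] no longer occurs. *)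
Lemma l_twist_sum i j nu t' a :
    (forall t t', \sum_s mu j i t s * nu s t' = (t == t')%:R) ->
  \sum_s nu s t' *: twist om^T (l j i s) a = adjmx (k i j t' a).
Proof.
move=> mu_nu; under eq_bigr do rewrite l_dual scaler_sumr.
rewrite exchange_big -[RHS](sum_delta t' (fun t => adjmx (k i j t a))).
apply: eq_bigr => t _; rewrite eq_sym -mu_nu scaler_suml.
by apply: eq_bigr => s _; rewrite scalerA mulrC.
Qed.

Lemma structure_coiso i j t t' :
  \sum_a k i j t a *m adjmx (k i j t' a) = ((t == t')%:R)%:M.
Proof.
have [nu mu_nu] := mu_right_inverse i j.
under eq_bigr do rewrite -(l_twist_sum _ _ mu_nu) mulmx_sumr.
rewrite exchange_big -mu_nu -scalar_mx_sum; apply: eq_bigr => s _.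
under eq_bigr do rewrite -scalemxAr.
by rewrite -scaler_sumr lk_diag scale_scalar_mx mulrC.
Qed.

Lemma structure_coiso0 i j j' t t' : j != j' ->
  \sum_a k i j' t a *m adjmx (k i j t' a) = 0.
Proof.
move=> ne_jj'; have [nu mu_nu] := mu_right_inverse i j.
under eq_bigr do rewrite -(l_twist_sum _ _ mu_nu) mulmx_sumr.
rewrite exchange_big big1 // => s _; under eq_bigr do rewrite -scalemxAr.
by rewrite -scaler_sumr lk_off // scaler0.
Qed.

Lemma structure_trans0 i i' j t t' : i != i' ->
  \sum_a adjmx (k i' j t a) *m k i j t' a = 0.
Proof.
move=> ne_ii'; have [nu mu_nu] := mu_right_inverse i' j.
under eq_bigr do rewrite -(l_twist_sum _ _ mu_nu) mulmx_suml.
rewrite exchange_big big1 // => s _; under eq_bigr do rewrite -scalemxAl.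
by rewrite -scaler_sumr -twist_contract kl_off // scaler0.
Qed.

(** The contraction equations show only that the sum is scalar. Cyclicity of the trace compares it
    with [structure_coiso], whence the ratio [q j / p i]. *)
Lemma structure_trans i j t t' : \sum_a adjmx (k i j t a) *m k i j t' a =
  ((t == t')%:R * ((q j)%:R / (p i)%:R))%:M.
Proof.
have [nu mu_nu] := mu_right_inverse i j.
have [c def_c] : exists c, \sum_a adjmx (k i j t a) *m k i j t' a = c%:M.
  exists (\sum_s nu s t * lam i j s t').
  under eq_bigr do rewrite -(l_twist_sum _ _ mu_nu) mulmx_suml.
  rewrite exchange_big -scalar_mx_sum; apply: eq_bigr => s _.
  under eq_bigr do rewrite -scalemxAl.
  by rewrite -scaler_sumr -twist_contract kl_diag scale_scalar_mx.
rewrite (scalar_mx_trace def_c).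
have -> : \tr (\sum_a adjmx (k i j t a) *m k i j t' a) =
    \tr (\sum_a k i j t' a *m adjmx (k i j t a)).
  by rewrite !raddf_sum; apply: eq_bigr => a _; apply: mxtrace_mulC.
rewrite structure_coiso mxtrace_scalar -[_ *+ q j]mulr_natr eq_sym.
by rewrite mulrC mulrA.
Qed.

(** Isometry of [l] provides a family [X] with [sum k X = 1]; multiplying by adjoints of [k] and
    applying [structure_trans] forces [X] to be [p i / q j] times the adjoint of [k]. *)
Lemma structure_cotrans j b b' :
  \sum_i \sum_t ((p i)%:R / (q j)%:R) *: (k i j t b *m adjmx (k i j t b')) =
    ((b == b')%:R)%:M.
Proof.
pose X i (t : 'I_(e i j)) c : 'M_(p i, q j) := \sum_s (mu j i t s)^* *:
  twist (map_mx Num.conj (invmx om)) (l j i s) c.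
have kX a c : \sum_i \sum_t k i j t a *m X i t c = ((a == c)%:R)%:M.
  transitivity (\sum_i \sum_s adjmx (twist om^T (l j i s) a) *m
      twist (map_mx Num.conj (invmx om)) (l j i s) c).
    apply: eq_bigr => i _.
    under eq_bigr do rewrite mulmx_sumr.
    rewrite exchange_big; apply: eq_bigr => s _; rewrite l_dual adjmx_sum.
    rewrite mulmx_suml; apply: eq_bigr => t _.
    by rewrite adjmxZ adjmxK -scalemxAr -scalemxAl.
  have expand i s : adjmx (twist om^T (l j i s) a) *m
      twist (map_mx Num.conj (invmx om)) (l j i s) c =
    \sum_d \sum_d' ((om d a)^* * (invmx om c d')^*) *:
      (adjmx (l j i s d) *m l j i s d').
    rewrite adjmx_twist mulmx_suml; apply: eq_bigr => d _.
    rewrite mulmx_sumr; apply: eq_bigr => d' _.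
    by rewrite -scalemxAl -scalemxAr scalerA !mxE.
  under eq_bigr do under eq_bigr do rewrite expand.
  under eq_bigr do rewrite exchange_big.
  rewrite exchange_big.
  transitivity (\sum_d ((om d a)^* * (invmx om c d)^*)%:M : 'M[C]_(q j)).
    apply: eq_bigr => d _.
    under eq_bigr do rewrite exchange_big.
    rewrite exchange_big.
    transitivity (\sum_d' (d == d')%:R *:
        (((om d a)^* * (invmx om c d')^*)%:M : 'M[C]_(q j))).
      apply: eq_bigr => d' _.
      under eq_bigr do rewrite -scaler_sumr.
      by rewrite -scaler_sumr l_iso !scale_scalar_mx mulrC.
    exact: sum_delta.
  rewrite scalar_mx_sum; congr (_%:M).
  have /matrixP/(_ c a) := mulVmx om_unit; rewrite !mxE => /(congr1 Num.conj).
  rewrite rmorph_sum conjC_nat eq_sym => <-; apply: eq_bigr => d _.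
  by rewrite rmorphM mulrC.
suff XE i t c : X i t c = ((p i)%:R / (q j)%:R) *: adjmx (k i j t c).
  by rewrite -kX; apply: eq_bigr => i _; apply: eq_bigr => t _;
     rewrite XE scalemxAr.
apply/matrixP => u v.
(* An entry [(u, v)] exists, so both dimensions are positive. *)
have [p_neq0 q_neq0] : (p i)%:R != 0 :> C /\ (q j)%:R != 0 :> C.
  by rewrite !pnatr_eq0 -!lt0n (leq_ltn_trans _ (ltn_ord u)) //
    (leq_ltn_trans _ (ltn_ord v)).
pose w := (p i)%:R / (q j)%:R : C.
suff -> : X i t c = w *: \sum_d adjmx (k i j t d) *m ((d == c)%:R)%:M.
  congr (fun A : 'M_(_, _) => (w *: A) u v).
  under eq_bigr do rewrite mul_mx_scalar eq_sym.
  exact: sum_delta.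
under eq_bigr do rewrite -kX mulmx_sumr.
rewrite exchange_big (bigD1 i) //= [X in _ + X]big1 ?addr0 => [|i' ne_i'i].
  under eq_bigr do rewrite mulmx_sumr.
  rewrite exchange_big; under eq_bigr => t' _.
    under eq_bigr do rewrite mulmxA.
    rewrite -mulmx_suml structure_trans mul_scalar_mx -scalerA.
  over.
  rewrite sum_delta scalerA /w mulrC mulrA divfK // divff // scale1r.
  by [].
under eq_bigr do rewrite mulmx_sumr.
rewrite exchange_big big1 // => t' _; under eq_bigr do rewrite mulmxA.
by rewrite -mulmx_suml structure_trans0 ?mul0mx.
Qed.

Lemma contract_biunitary : biunitary k.
Proof.
split; [exact: k_iso | exact: structure_coiso | exact: structure_coiso0
  | exact: structure_trans | exact: structure_trans0 | exact: structure_cotrans].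
Qed.

End Structure.

(** * The inverse channel of a biunitary dilation *)

Section Inverse.
Variables (m n h : nat) (p : 'I_m -> nat) (q : 'I_n -> nat).
Variable e : 'I_m -> 'I_n -> nat.
Variable k : forall i j, 'I_(e i j) -> 'I_h -> 'M[C]_(q j, p i).
Arguments k : clear implicits.
Variables (om : 'M[C]_h) (g : forall i j, 'M[C]_(e i j)).
Hypothesis k_bi : biunitary k.
Hypothesis om_unit : om \in unitmx.
Hypothesis k_int : forall i j t a,
  twist (adjmx om *m om) (k i j t) a = \sum_t' g i j t t' *: k i j t' a.

(** Moving [om] across produces the twist by [adjmx om *m om], which [g] computes; [biunitary_coiso]
    then selects one coefficient. This exhibits [g] as a Gram matrix. *)
Lemma twist_gram i j t t' :
  \sum_c twist om (k i j t) c *m adjmx (twist om (k i j t') c) = (g i j t t')%:M.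
Proof.
under eq_bigr do rewrite adjmx_twist.
rewrite twist_contract -/(adjmx om).
under eq_bigr do rewrite twistM k_int mulmx_suml.
rewrite exchange_big -[RHS](sum_delta t' (fun t'' => (g i j t t'')%:M)).
apply: eq_bigr => t'' _; under eq_bigr do rewrite -scalemxAl.
rewrite -scaler_sumr (biunitary_coiso k_bi) !scale_scalar_mx mulrC.
by rewrite [t'' == t']eq_sym.
Qed.

Lemma intertwiner_psdmx i j : psdmx (((p i)%:R / (q j)%:R) *: g i j).
Proof.
(* For [q j = 0] the inverse is [0] by convention and the scaled matrix vanishes; otherwise a single
   row of the twisted slices already gives [g] as a Gram matrix. *)
have [q0|q_gt0] := posnP (q j).
  by rewrite q0 invr0 mulr0 scale0r => v; rewrite mulmx0 mul0mx mxE.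
pose B := \matrix_(t, z) twist om (k i j t) (mxtens_unindex z).2
  (Ordinal q_gt0) (mxtens_unindex z).1 : 'M[C]_(e i j, p i * h).
have -> : g i j = B *m adjmx B.
  apply/matrixP => t t'; transitivity (((g i j t t')%:M : 'M_(q j))
      (Ordinal q_gt0) (Ordinal q_gt0)); first by rewrite mxE eqxx mulr1n.
  rewrite -twist_gram summxE mxE big_mxtens exchange_big.
  apply: eq_bigr => c _; rewrite mxE; apply: eq_bigr => a _.
  by rewrite !adjmxE !mxE !mxtens_indexK.
move=> v; rewrite -scalemxAr -scalemxAl mxE mulr_ge0 ?divr_ge0 ?ler0n //.
exact: psdmx_gram.
Qed.

Lemma intertwiner_sqrt : exists mu : forall i j, 'M[C]_(e i j),
  forall i j, ((p i)%:R / (q j)%:R) *: g i j = mu i j *m adjmx (mu i j).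
Proof.
apply: (@fin_all_exists _ (fun i => forall j, 'M[C]_(e i j)) (fun i mu =>
  forall j, ((p i)%:R / (q j)%:R) *: g i j = mu j *m adjmx (mu j))) => i.
apply: (@fin_all_exists _ (fun j => 'M[C]_(e i j)) (fun j mu =>
  ((p i)%:R / (q j)%:R) *: g i j = mu *m adjmx mu)) => j.
exact/psdmx_factor/intertwiner_psdmx.
Qed.

Variable mu : forall i j, 'M[C]_(e i j).
Hypothesis mu_gram : forall i j,
  ((p i)%:R / (q j)%:R) *: g i j = mu i j *m adjmx (mu i j).

Definition inverse_twisted j i (s : 'I_(e i j)) (a : 'I_h) : 'M[C]_(p i, q j) :=
  \sum_t mu i j t s *: adjmx (k i j t a).

Definition inverse_slices j i (s : 'I_(e i j)) : 'I_h -> 'M[C]_(p i, q j) :=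
  twist (invmx om)^T (@inverse_twisted j i s).

Lemma twist_inverse_slices j i s a :
  twist om^T (@inverse_slices j i s) a = inverse_twisted s a.
Proof. by rewrite twistM -trmx_mul mulVmx // trmx1 twist1. Qed.

(** The twist moves onto the inverse slices and cancels there; the factor [q j / p i] comes from
    [biunitary_trans]. In the opposite order [biunitary_coiso] leaves [mu] itself. *)
Lemma inverse_contract_diag : contract_diag k (@inverse_slices) om
  (fun i j s t => mu i j t s * ((q j)%:R / (p i)%:R)).
Proof.
move=> i j s t; rewrite twist_contract.
under eq_bigr do rewrite twist_inverse_slices mulmx_suml.
rewrite exchange_big -[RHS](sum_delta t
  (fun t' => (mu i j t' s * ((q j)%:R / (p i)%:R))%:M)).
apply: eq_bigr => t' _; under eq_bigr do rewrite -scalemxAl.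
rewrite -scaler_sumr (biunitary_trans k_bi) !scale_scalar_mx eq_sym.
by rewrite mulrCA.
Qed.

Lemma inverse_contract_offdiag : contract_offdiag k (@inverse_slices) om.
Proof.
move=> i i' j s t ne_ii'; rewrite twist_contract.
under eq_bigr do rewrite twist_inverse_slices mulmx_suml.
rewrite exchange_big big1 // => t' _; under eq_bigr do rewrite -scalemxAl.
by rewrite -scaler_sumr (biunitary_trans0 k_bi) ?scaler0.
Qed.

Lemma inverse_contract_diag_tr : contract_diag (@inverse_slices) k om^T
  (fun j i t s => mu i j t s).
Proof.
move=> j i t s; under eq_bigr do rewrite twist_inverse_slices mulmx_sumr.
rewrite exchange_big -[RHS](sum_delta t (fun t' => (mu i j t' s)%:M)).
apply: eq_bigr => t' _; under eq_bigr do rewrite -scalemxAr.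
by rewrite -scaler_sumr (biunitary_coiso k_bi) !scale_scalar_mx mulrC.
Qed.

Lemma inverse_contract_offdiag_tr : contract_offdiag (@inverse_slices) k om^T.
Proof.
move=> j j' i t s ne_jj'.
under eq_bigr do rewrite twist_inverse_slices mulmx_sumr.
rewrite exchange_big big1 // => t' _; under eq_bigr do rewrite -scalemxAr.
by rewrite -scaler_sumr (biunitary_coiso0 k_bi) ?scaler0.
Qed.

(** Summing over [s] turns [mu] into [p i / q j] times [g], which acts on [k] as the twist by
    [adjmx om *m om]; [biunitary_cotrans] absorbs the weights. *)
Lemma inverse_twisted_gram j a b :
  \sum_i \sum_s adjmx (@inverse_twisted j i s a) *m inverse_twisted s b =
  ((adjmx om *m om) a b)%:M.
Proof.
transitivity (\sum_i \sum_t ((p i)%:R / (q j)%:R) *: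
    (twist (adjmx om *m om) (k i j t) a *m adjmx (k i j t b))).
  apply: eq_bigr => i _.
  transitivity (\sum_t \sum_t' (\sum_s (mu i j t' s)^* * mu i j t s) *:
      (k i j t' a *m adjmx (k i j t b))).
    under eq_bigr do rewrite mulmx_sumr.
    rewrite exchange_big; apply: eq_bigr => t _.
    under [RHS]eq_bigr do rewrite scaler_suml.
    rewrite [RHS]exchange_big; apply: eq_bigr => s _.
    rewrite adjmx_sum mulmx_suml; apply: eq_bigr => t' _.
    by rewrite adjmxZ adjmxK -scalemxAl -scalemxAr scalerA.
  apply: eq_bigr => t _; rewrite k_int mulmx_suml scaler_sumr.
  apply: eq_bigr => t' _; rewrite -scalemxAl scalerA; congr (_ *: _).
  have /matrixP/(_ t t') := mu_gram i j; rewrite !mxE => ->.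
  by apply: eq_bigr => s _; rewrite !mxE mulrC.
rewrite -[RHS](sum_delta b (fun c => ((adjmx om *m om) a c)%:M)).
transitivity (\sum_c (adjmx om *m om) a c *: \sum_i \sum_t
    ((p i)%:R / (q j)%:R) *: (k i j t c *m adjmx (k i j t b))).
  under [RHS]eq_bigr do rewrite scaler_sumr.
  rewrite [RHS]exchange_big; apply: eq_bigr => i _.
  under [RHS]eq_bigr do rewrite scaler_sumr.
  rewrite [RHS]exchange_big; apply: eq_bigr => t _.
  rewrite mulmx_suml scaler_sumr; apply: eq_bigr => c _.
  by rewrite -scalemxAl !scalerA mulrC.
apply: eq_bigr => c _; rewrite (biunitary_cotrans k_bi) !scale_scalar_mx eq_sym.
by rewrite mulrC.
Qed.

(** Untwisting sandwiches the Gram matrix [adjmx om *m om] between [adjmx (invmx om)] and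
    [invmx om]. *)
Lemma inverse_isometric : isometric (@inverse_slices).
Proof.
move=> j a b.
transitivity (\sum_c \sum_d ((invmx om c a)^* * invmx om d b) *:
    (((adjmx om *m om) c d)%:M : 'M[C]_(q j))).
  under [RHS]eq_bigr do under eq_bigr do rewrite -inverse_twisted_gram.
  under [RHS]eq_bigr do under eq_bigr do rewrite scaler_sumr.
  under [RHS]eq_bigr do rewrite exchange_big.
  rewrite [RHS]exchange_big; apply: eq_bigr => i _.
  under [RHS]eq_bigr do under eq_bigr do rewrite scaler_sumr.
  under [RHS]eq_bigr do rewrite exchange_big.
  rewrite [RHS]exchange_big; apply: eq_bigr => s _.
  rewrite adjmx_twist mulmx_suml; apply: eq_bigr => c _.
  rewrite mulmx_sumr; apply: eq_bigr => d _.
  by rewrite -scalemxAl -scalemxAr scalerA !mxE.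
under eq_bigr do under eq_bigr do rewrite scale_scalar_mx.
under eq_bigr do rewrite scalar_mx_sum.
rewrite scalar_mx_sum; congr (_%:M).
have /matrixP/(_ a b) : adjmx (invmx om) *m (adjmx om *m om) *m invmx om = 1%:M.
  by rewrite mulmxA -adjmxM mulmxV // adjmx_scalar conjC1 mul1mx mulmxV.
rewrite [1%:M _ _]mxE => <-; rewrite mxE exchange_big; apply: eq_bigr => d _.
rewrite [X in X * _]mxE mulr_suml; apply: eq_bigr => c _.
by rewrite adjmxE mulrAC.
Qed.

Lemma mu_norm i j : \sum_s \sum_t mu i j t s * (mu i j t s)^* =
  (p i)%:R / (q j)%:R * \tr (g i j).
Proof.
rewrite exchange_big mulr_sumr; apply: eq_bigr => t _.
have /matrixP/(_ t t) := mu_gram i j; rewrite !mxE => ->.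
by apply: eq_bigr => s _; rewrite !mxE.
Qed.

Hypothesis om_trace : \tr (adjmx om *m om) = 1.

(** The numbers are compared as scalar operators on [C^(p i)]: the sum of [adjmx k] times the twist
    of [k] by [adjmx om *m om] is evaluated once through [g] and [biunitary_trans], once through
    [biunitary_iso], which yields the trace. *)
Lemma inverse_norm i : (0 < p i)%N ->
  \sum_j \sum_s \sum_t (mu i j t s * ((q j)%:R / (p i)%:R)) *
    (mu i j t s * ((q j)%:R / (p i)%:R))^* = 1.
Proof.
move=> p_gt0; have p_neq0 : (p i)%:R != 0 :> C by rewrite pnatr_eq0 -lt0n.
apply: (scalar_mx_inj p_gt0); rewrite -[1 in RHS]om_trace /mxtrace -!scalar_mx_sum.
transitivity (\sum_a \sum_j \sum_t adjmx (k i j t a) *m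
    twist (adjmx om *m om) (k i j t) a).
  rewrite [RHS]exchange_big; apply: eq_bigr => j _; rewrite [RHS]exchange_big.
  transitivity ((((q j)%:R / (p i)%:R) * \tr (g i j))%:M : 'M[C]_(p i)).
    congr (_%:M); transitivity (((q j)%:R / (p i)%:R) * ((q j)%:R / (p i)%:R) *
      \sum_s \sum_t mu i j t s * (mu i j t s)^*).
      rewrite mulr_sumr; apply: eq_bigr => s _; rewrite mulr_sumr.
      apply: eq_bigr => t _; rewrite rmorphM fmorph_div !rmorph_nat.
      by rewrite mulrACA mulrC.
    rewrite mu_norm; have [->|q_neq0] := eqVneq ((q j)%:R : C) 0.
      by rewrite !mul0r.
    by field; rewrite p_neq0 q_neq0.
  rewrite mulr_sumr -scalar_mx_sum; apply: eq_bigr => t _.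
  under eq_bigr do rewrite k_int mulmx_sumr.
  rewrite exchange_big -[LHS](sum_delta t
    (fun t' => ((q j)%:R / (p i)%:R * g i j t t')%:M)).
  apply: eq_bigr => t' _; under [RHS]eq_bigr do rewrite -scalemxAr.
  rewrite -scaler_sumr (biunitary_trans k_bi) !scale_scalar_mx.
  by congr (_%:M); ring.
apply: eq_bigr => a _.
rewrite -[RHS](sum_delta a (fun b => ((adjmx om *m om) a b)%:M)).
under eq_bigr do under eq_bigr do rewrite mulmx_sumr.
under eq_bigr do rewrite exchange_big.
rewrite exchange_big; apply: eq_bigr => b _.
under eq_bigr do under eq_bigr do rewrite -scalemxAr.
under eq_bigr do rewrite -scaler_sumr.
by rewrite -scaler_sumr (biunitary_iso k_bi) !scale_scalar_mx mulrC.
Qed.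

(** The same comparison on [C^(q j)], with the diagonal terms of [inverse_twisted_gram] and
    [biunitary_coiso]. *)
Lemma inverse_norm_tr j : (0 < q j)%N ->
  \sum_i \sum_t \sum_s mu i j t s * (mu i j t s)^* = 1.
Proof.
move=> q_gt0; apply: (scalar_mx_inj q_gt0).
rewrite -[1 in RHS]om_trace /mxtrace -!scalar_mx_sum.
under [RHS]eq_bigr do rewrite -(inverse_twisted_gram j).
rewrite [RHS]exchange_big; apply: eq_bigr => i _; rewrite [RHS]exchange_big.
under [RHS]eq_bigr do under eq_bigr do rewrite adjmx_sum mulmx_suml.
rewrite [X in X%:M = _]exchange_big -scalar_mx_sum; apply: eq_bigr => s _.
rewrite [RHS]exchange_big -scalar_mx_sum; apply: eq_bigr => t _.
under [RHS]eq_bigr do rewrite mulmx_sumr.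
rewrite [RHS]exchange_big -[LHS](sum_delta t
  (fun t' => (mu i j t' s * (mu i j t s)^*)%:M)).
apply: eq_bigr => t' _.
under [RHS]eq_bigr do rewrite adjmxZ adjmxK -scalemxAl -scalemxAr.
rewrite -!scaler_sumr (biunitary_coiso k_bi) !scale_scalar_mx.
by congr (_%:M); ring.
Qed.

End Inverse.

(** * Entanglement-invertible channels *)

(** A triple sum with dependent bounds becomes a sum over one finite type, as [kraus_eq0] and
    [kraus_id] expect. *)
Lemma sig_sum3 (V : nmodType) n (a b : 'I_n -> nat)
    (F : forall j, 'I_(a j) -> 'I_(b j) -> V) :
  \sum_j \sum_s \sum_t F j s t =
  \sum_(z : {j & ('I_(a j) * 'I_(b j))%type}) F (tag z) (tagged z).1 (tagged z).2.
Proof. by under eq_bigr do rewrite pair_bigA; rewrite sig_big_dep. Qed.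

Section Composition.
Variables (m n h : nat) (p : 'I_m -> nat) (q : 'I_n -> nat).
Variables (e : 'I_m -> 'I_n -> nat) (f : 'I_n -> 'I_m -> nat).
Variable K : forall i j, 'I_(e i j) -> 'M[C]_(q j, p i * h).
Variable L : forall j i, 'I_(f j i) -> 'M[C]_(p i, q j * h).
Arguments K : clear implicits.
Arguments L : clear implicits.
Variables (M : mmap C (fun i => p i * h)%N q) (N : mmap C (fun j => q j * h)%N p).
Arguments M : clear implicits.
Arguments N : clear implicits.
Hypothesis MK : forall i j rho, M i j rho = kraus (K i j) rho.
Hypothesis NL : forall j i rho, N j i rho = kraus (L j i) rho.
Variable om : 'M[C]_h.

Let k i j t := slice (K i j t).
Let l j i s := slice (L j i s).

Lemma mapply_ext_kraus rho i' : mapply N (ext_apply M (Wom om) rho) i' =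
  \sum_i \sum_j \sum_s \sum_t (\sum_b l s b *m twist om (@k i j t) b) *m rho i *m
    adjmx (\sum_b @l j i' s b *m twist om (@k i j t) b).
Proof.
rewrite /mapply exchange_big; apply: eq_bigr => j _.
rewrite NL /kraus exchange_big; apply: eq_bigr => s _.
rewrite /ext_apply mulmx_sumr mulmx_suml; apply: eq_bigr => i _.
have -> : ampR (M i j) (tens3 (rho i) (Wom om)) =
    ampR (kraus (K i j)) (tens3 (rho i) (Wom om)).
  by apply: eq_bigr => a _; apply: eq_bigr => b _; rewrite MK.
rewrite ampR_kraus /kraus mulmx_sumr mulmx_suml; apply: eq_bigr => t _.
by rewrite -mul_bend adjmxM !mulmxA.
Qed.

(** On a family supported in block [i] the composite is the identity into block [i] and zero into
    the others, so [kraus_id] and [kraus_eq0] apply. *)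
Lemma contract_of_inverts :
    (forall (rho : mmalg C p) i, mapply N (ext_apply M (Wom om) rho) i = rho i) ->
  exists lam : forall i j, 'I_(f j i) -> 'I_(e i j) -> C,
    contract_diag k l om lam /\ contract_offdiag k l om.
Proof.
move=> MN; pose V i i' j s t : 'M[C]_(p i', p i) :=
  \sum_b @l j i' s b *m twist om (@k i j t) b.
have sumV i i' (rho : 'M[C]_(p i)) :
    \sum_(z : {j & ('I_(f j i') * 'I_(e i j))%type})
      V i i' (tag z) (tagged z).1 (tagged z).2 *m rho *m
      adjmx (V i i' (tag z) (tagged z).1 (tagged z).2) =
    @dfwith _ (fun i => 'M[C]_(p i)) (fun=> 0) i rho i'.
  rewrite -MN mapply_ext_kraus -(sig_sum3 (fun j s t =>
    V i i' j s t *m rho *m adjmx (V i i' j s t))).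
  rewrite [RHS](bigD1 i) //= dfwith_in [X in _ = _ + X]big1 ?addr0 //.
  move=> i'' ne_i''i; rewrite dfwith_out; last by rewrite eq_sym.
  by rewrite !big1 // => j _; rewrite !big1 // => s _; rewrite !big1 // => t _;
    rewrite mulmx0 mul0mx.
exists (fun i j s t => ((p i)%:R)^-1 * \tr (V i i j s t)); split.
  move=> i j s t; have VI rho := etrans (sumV i i rho) (dfwith_in _ _).
  exact: (kraus_id VI (Tagged _ (s, t))).
move=> i i' j s t ne_ii'.
have V0 rho := etrans (sumV i i' rho) (dfwith_out _ _ ne_ii').
exact: (kraus_eq0 V0 (Tagged _ (s, t))).
Qed.

Lemma inverts_of_contract lam :
    contract_diag k l om lam -> contract_offdiag k l om ->
    (forall i, (0 < p i)%N ->
      \sum_j \sum_s \sum_t lam i j s t * (lam i j s t)^* = 1) ->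
  forall (rho : mmalg C p) i, mapply N (ext_apply M (Wom om) rho) i = rho i.
Proof.
move=> kl_diag kl_off lam1 rho i; rewrite mapply_ext_kraus.
rewrite (bigD1 i) //= [X in _ + X]big1 ?addr0 => [|i' ne_i'i]; last first.
  by rewrite big1 // => j _; rewrite big1 // => s _; rewrite big1 // => t _;
    rewrite kl_off // !mul0mx.
transitivity ((\sum_j \sum_s \sum_t lam i j s t * (lam i j s t)^*) *: rho i).
  rewrite scaler_suml; apply: eq_bigr => j _.
  rewrite scaler_suml; apply: eq_bigr => s _.
  rewrite scaler_suml; apply: eq_bigr => t _.
  rewrite kl_diag adjmx_scalar mul_scalar_mx -scalemxAl mul_mx_scalar.
  by rewrite scalerA.
(* A block of dimension zero has no normalisation, but also no entry to check. *)
have [p0|p_gt0] := posnP (p i); last by rewrite lam1 // scale1r.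
by apply/matrixP => u; have := ltn_ord u; rewrite {2}p0.
Qed.

End Composition.

Lemma mxtens_index_eq p q (a c : 'I_p) (b d : 'I_q) :
  (mxtens_index (a, b) == mxtens_index (c, d)) = (a == c) && (b == d).
Proof. by rewrite (can_eq (@mxtens_indexK _ _)). Qed.

Lemma slice_isometric m n h (p : 'I_m -> nat) (q : 'I_n -> nat)
    (e : 'I_m -> 'I_n -> nat)
    (K : forall i j, 'I_(e i j) -> 'M[C]_(q j, p i * h)) :
  (forall i, \sum_j \sum_t adjmx (K i j t) *m K i j t = 1%:M) <->
  isometric (fun i j t => slice (K i j t)).
Proof.
have entry i a b u v :
    (\sum_j \sum_t adjmx (slice (K i j t) a) *m slice (K i j t) b) u v =
    (\sum_j \sum_t adjmx (K i j t) *m K i j t)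
      (mxtens_index (u, a)) (mxtens_index (v, b)).
  rewrite !summxE; apply: eq_bigr => j _.
  by rewrite !summxE; apply: eq_bigr => t _; rewrite slice_gram.
have one i (a b : 'I_h) u v : ((a == b)%:R%:M : 'M[C]_(p i)) u v =
    (1%:M : 'M_(p i * h)) (mxtens_index (u, a)) (mxtens_index (v, b)).
  by rewrite !mxE mxtens_index_eq; case: (u == v); rewrite ?mulr0n ?mulr1n.
split=> [K_iso i a b|k_iso i]; apply/matrixP => u v.
  by rewrite entry K_iso one.
case: (mxtens_indexP u) => u' a; case: (mxtens_indexP v) => v' b.
by rewrite -entry k_iso one.
Qed.

(** * Invertibility of [M] in terms of its slices *)

Section Main.
Variables (m n h : nat) (x : 'I_m -> nat) (y : 'I_n -> nat).
Variable e : 'I_m -> 'I_n -> nat.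
Variable M : mmap C (fun i => x i * h)%N y.
Variable K : forall i j, 'I_(e i j) -> 'M[C]_(y j, x i * h).
Arguments K : clear implicits.
Arguments M : clear implicits.
Hypothesis MK : forall i j rho, M i j rho = kraus (K i j) rho.
Variable om : 'M[C]_h.
Hypothesis om_unit : om \in unitmx.

Let k i j t := slice (K i j t).
Arguments k : clear implicits.

Lemma ent_invertible_biunitary : channel M ->
    (forall i j (c : 'I_(e i j) -> C),
      (forall a, \sum_t c t *: k i j t a = 0) -> forall t, c t = 0) ->
    ent_invertible M (Wom om) ->
  biunitary k /\ exists g : forall i j, 'M_(e i j), forall i j t a,
    twist (adjmx om *m om) (k i j t) a = \sum_t' g i j t t' *: k i j t' a.
Proof.
move=> M_ch k_free [N [N_ch MN NM]].
have [L NL] := channel_kraus N_ch.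
have k_iso : isometric k := (slice_isometric K).1 (channel_gram M_ch MK).
have l_iso := (slice_isometric L).1 (channel_gram N_ch NL).
have [lam [kl_diag kl_off]] := contract_of_inverts MK NL MN.
(* Swapping [W_om] transposes [om], so the second equation is the first with [M] and [N]
   exchanged. *)
rewrite swapmx_Wom in NM.
have [mu [lk_diag lk_off]] := contract_of_inverts NL MK NM.
split; first exact: contract_biunitary lk_diag lk_off om_unit k_free.
exists (intertwining lam mu) => i j t a.
exact: (twist_intertwining k_iso l_iso kl_diag kl_off lk_diag lk_off).
Qed.

Lemma biunitary_ent_invertible (g : forall i j, 'M[C]_(e i j)) :
    \tr (adjmx om *m om) = 1 -> biunitary k ->
    (forall i j t a, twist (adjmx om *m om) (k i j t) a =
      \sum_t' g i j t t' *: k i j t' a) ->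
  ent_invertible M (Wom om).
Proof.
move=> om_trace k_bi k_int.
have [mu mu_gram] := intertwiner_sqrt k_bi k_int.
pose l j i s := @inverse_slices m n h x y e k om mu j i s.
pose L j i s := unslice (l j i s).
have Ll j i s : slice (L j i s) =1 l j i s by move=> a; apply: unsliceK.
exists (fun j i => kraus (L j i)); split.
- apply: kraus_channel; apply/slice_isometric => j a b.
  rewrite -(inverse_isometric k_bi om_unit k_int mu_gram).
  by apply: eq_bigr => i _; apply: eq_bigr => s _; rewrite !Ll.
- apply: (inverts_of_contract MK (fun j i rho => erefl)
    (lam := fun i j s t => mu i j t s * ((y j)%:R / (x i)%:R))).
  + move=> i j s t; rewrite -(inverse_contract_diag k_bi om_unit).
    by apply: eq_bigr => b _; rewrite Ll.
  + move=> i i' j s t ne; rewrite -[RHS](inverse_contract_offdiag k_bi om_unit mu s t ne).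
    by apply: eq_bigr => b _; rewrite Ll.
  + move=> i; exact: (inverse_norm k_bi k_int mu_gram om_trace).
rewrite swapmx_Wom.
apply: (inverts_of_contract (fun j i rho => erefl) MK
    (lam := fun j i t s => mu i j t s)).
- move=> j i t s; rewrite -(inverse_contract_diag_tr k_bi om_unit).
  by apply: eq_bigr => b _; rewrite (eq_twist _ _ (Ll j i s)).
- move=> j j' i t s ne; rewrite -[RHS](inverse_contract_offdiag_tr k_bi om_unit mu t s ne).
  by apply: eq_bigr => b _; rewrite (eq_twist _ _ (Ll j i s)).
- move=> j; exact: (inverse_norm_tr k_bi k_int mu_gram om_trace).
Qed.

End Main.

(** * The dilation [tau], the reduced state and [Phi_H] *)

Lemma kraus_braE p q r (T : 'M[C]_(q * r, p)) rho :
  kraus (braE T) rho = ptr2 (T *m rho *m adjmx T).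
Proof.
apply/matrixP => u v; rewrite summxE [RHS]mxE; apply: eq_bigr => t _.
by rewrite !sandwichE; apply: eq_bigr => a _; apply: eq_bigr => b _; rewrite !mxE.
Qed.

Lemma slice_braE_sum p q r h (T : 'M[C]_(q * r, p * h)) (c : 'I_r -> C) :
  (forall a, \sum_t c t *: slice (braE T t) a = 0) -> \sum_t c t *: braE T t = 0.
Proof.
move=> T0; apply/matrixP => u v; case: (mxtens_indexP v) => v' a.
have /matrixP/(_ u v') := T0 a; rewrite !summxE !mxE; apply: etrans.
by apply: eq_bigr => t _; rewrite !mxE.
Qed.

Lemma ptr2_Wom h (om : 'M[C]_h) : ptr2 (Wom om) = (adjmx om *m om)^T.
Proof.
apply/matrixP => u v; rewrite !mxE; apply: eq_bigr => t _.
by rewrite !mxE big_ord1 !mxE !mxtens_indexK mulrC.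
Qed.

(** Entrywise comparison. The transpose on [G] matches the one in [ptr2_Wom], so the reduced state
    acts on slices as the twist by [adjmx om *m om]. *)
Lemma intertwiner_slices p q r h (T : 'M[C]_(q * r, p * h)) (G : 'M[C]_h)
    (g : 'M[C]_r) :
  T *m (1%:M *t G^T) = (1%:M *t g) *m T <->
  forall t a, twist G (slice (braE T t)) a =
    \sum_t' g t t' *: slice (braE T t') a.
Proof.
have lhs u t v a : (T *m (1%:M *t G^T)) (mxtens_index (u, t)) (mxtens_index (v, a))
    = twist G (slice (braE T t)) a u v.
  rewrite mxE big_mxtens (bigD1 v) //= [X in _ + X]big1 ?addr0 => [|w ne_wv].
    rewrite summxE; apply: eq_bigr => b _.
    by rewrite tensmxE !mxE eqxx mul1r mulrC.
  by apply: big1 => b _; rewrite tensmxE mxE (negPf ne_wv) mul0r mulr0.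
have rhs u t v a : ((1%:M *t g) *m T) (mxtens_index (u, t)) (mxtens_index (v, a))
    = (\sum_t' g t t' *: slice (braE T t') a) u v.
  rewrite mxE big_mxtens (bigD1 u) //= [X in _ + X]big1 ?addr0 => [|w ne_wu].
    rewrite summxE; apply: eq_bigr => b _.
    by rewrite tensmxE !mxE eqxx mul1r.
  by apply: big1 => b _; rewrite tensmxE mxE eq_sym (negPf ne_wu) !mul0r.
split=> [Tg t a|Tg]; apply/matrixP => u v; first by rewrite -lhs Tg rhs.
case: (mxtens_indexP u) => u' t; case: (mxtens_indexP v) => v' a.
by rewrite lhs rhs Tg.
Qed.

Lemma PhiH_Wom h : PhiH C h = Wom (sqrtC (h%:R)^-1)%:M.
Proof.
set s := sqrtC _; have ss : s * s^* = (h%:R)^-1.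
  by rewrite conj_Creal ?ger0_real ?sqrtC_ge0 ?invr_ge0 ?ler0n // -expr2 sqrtCK.
apply/matrixP => u v; rewrite !mxE !big_ord1 !mxE -ss !rmorphMn /= conjC1.
by rewrite !mulrnAl !mulrnAr !mulr1.
Qed.

End EntanglementInvertibility.

Theorem mainTheorem5 (C : numClosedFieldType) (m n h : nat)
  (x : 'I_m -> nat) (y : 'I_n -> nat) (omega : 'M[C]_h)
  (M : mmap C (fun i => x i * h)%N y)
  (e : 'I_n -> 'I_m -> nat)
  (tau : forall i j, 'M[C]_(y j * e j i, x i * h)) :
  omega \in unitmx ->
  \tr (adjmx omega *m omega) = 1 ->
  channel M ->
  minimal_dilation M e tau ->
  (ent_invertible M (Wom omega) <->
     ent_invertible M (PhiH C h) /\ self_intertwiner e tau (ptr2 (Wom omega))).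
Proof.
move=> om_unit om_trace M_ch [Mtau tau_free].
(* Trace one excludes [h = 0], so [h] is invertible in [C]. *)
have h_gt0 : (0 < h)%N.
  rewrite lt0n; apply: contra_eqN om_trace => /eqP h0.
  rewrite /mxtrace big1 1?eq_sym ?oner_eq0 // => i _.
  by have := ltn_ord i; rewrite {2}h0.
have h_neq0 : h%:R != 0 :> C by rewrite pnatr_eq0 -lt0n.
pose K i j := braE (tau i j).
have MK i j rho : M i j rho = kraus (K i j) rho by rewrite kraus_braE Mtau.
have k_free i j (c : 'I_(e j i) -> C) :
    (forall a, \sum_t c t *: slice (K i j t) a = 0) -> forall t, c t = 0.
  by move/slice_braE_sum/tau_free.
pose s : C := sqrtC (h%:R)^-1; pose om0 : 'M[C]_h := s%:M.
have s_neq0 : s != 0 by rewrite sqrtC_eq0 invr_eq0.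
have om0_unit : om0 \in unitmx by rewrite unitmxE det_scalar unitrX ?unitfE.
have om0_gram : adjmx om0 *m om0 = ((h%:R)^-1)%:M.
  rewrite adjmx_scalar -scalar_mxM -[in RHS](sqrtCK (h%:R)^-1) expr2.
  by rewrite conj_Creal // ger0_real ?sqrtC_ge0 ?invr_ge0 ?ler0n.
have om0_trace : \tr (adjmx om0 *m om0) = 1.
  by rewrite om0_gram mxtrace_scalar -[LHS]mulr_natr mulVf.
rewrite PhiH_Wom ptr2_Wom -/s -/om0; split=> [inv|[inv [g tau_g]]].
  have [k_bi [g k_int]] := ent_invertible_biunitary MK om_unit M_ch k_free inv.
  split; last by exists g => i j; apply/intertwiner_slices/k_int.
  (* The Gram matrix of [om0] is the scalar [1 / h], which is therefore its own intertwiner. *)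
  apply: (biunitary_ent_invertible MK om0_unit (g := fun i j => ((h%:R)^-1)%:M))
    => // i j t a.
  rewrite om0_gram /twist.
  under eq_bigr do rewrite mxE -[_ *+ (_ == _)]mulr_natl -scalerA.
  under [RHS]eq_bigr do rewrite mxE -[_ *+ (_ == _)]mulr_natl -scalerA.
  by rewrite !sum_delta.
(* Biunitarity does not mention the state: obtained here from [Phi_H], it is used for [omega] with
   the given [g]. *)
have [k_bi _] := ent_invertible_biunitary MK om0_unit M_ch k_free inv.
apply: (biunitary_ent_invertible MK om_unit om_trace k_bi (g := g)) => i j.
exact/intertwiner_slices.
Qed.
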